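(* Let $BE(1,0)$ be the set of real numbers $x$ such that, in the dyadic expansion $\{x\}=0.d_1d_2\ldots$ of the fractional part of $x$, the set $\{i : d_i=1\}$ has density zero. Then $BE(1,0)$ is immeasurable; that is, it is either null or non-$\sigma$-finite for every translation invariant Borel measure on $\mathbb{R}$.
   Context: The fractional part is $\{x\}=x-\lfloor x\rfloor$; if it has two dyadic (base-2) expansions, the one with finitely many nonzero digits is chosen. The density of a set $A$ of natural numbers is $\lim_{n\to\infty}\mathrm{card}(A\cap[1,n])/n$, if the limit exists. A Borel measure on $\mathbb{R}$ is a (countably additive, $[0,\infty]$-valued) measure $\mu$ defined on a $\sigma$-algebra $\mathcal{S}$ of subsets of $\mathbb{R}$ containing all Borel sets ($\mathcal S$ may be larger than the Borel $\sigma$-algebra, and $\mu$ is not assumed to be $\sigma$-finite on $\mathbb{R}$). It is translation invariant if $S+t\in\mathcal{S}$ and $\mu(S+t)=\mu(S)$ for all $S\in\mathcal{S}$, $t\in\mathbb{R}$. A Borel set $B$ is $\sigma$-finite for $\mu$ if it is a countable union of sets in $\mathcal{S}$ of finite $\mu$-measure. A nonempty Borel set $B\subset\mathbb{R}$ is called immeasurable if for every translation invariant Borel measure $\mu$ on $\mathbb{R}$, either $\mu(B)=0$ or $B$ is not $\sigma$-finite for $\mu$. *)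

(* Defs.v *)
From HB Require Import structures.
From mathcomp Require Import all_boot all_order all_algebra finmap.
From mathcomp Require Import all_classical all_reals all_analysis.

Set Implicit Arguments.
Unset Strict Implicit.
Unset Printing Implicit Defensive.

Import Order.TTheory GRing.Theory Num.Theory.
Import numFieldNormedType.Exports.

Local Open Scope classical_set_scope.
Local Open Scope ring_scope.

Definition frac_part (R : realType) (x : R) : R := x - (Num.floor x)%:~R.

(* Binary digits are indexed from 1, as in 0.d_1 d_2 ...; the value d 0 is
   never used. *)
Definition is_dyadic_expansion (R : realType) (d : nat -> bool) (y : R) : Prop :=
  (fun n : nat => \sum_(1 <= i < n.+1) (d i)%:R / 2 ^+ i : R) @ \oo --> y.

Definition dyadic_digits (R : realType) (d : nat -> bool) (y : R) : Prop :=
  is_dyadic_expansion d y /\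
  ((exists d' : nat -> bool, is_dyadic_expansion d' y /\
      exists2 i, (0 < i)%N & d' i != d i) ->
   finite_set [set i | (0 < i)%N /\ d i]).

Definition has_density (R : realType) (A : set nat) (l : R) : Prop :=
  (fun n : nat => #|` fset_set (A `&` [set i | (1 <= i <= n)%N])|%fset%:R / n%:R : R)
    @ \oo --> l.

Definition BE10 (R : realType) : set R :=
  [set x | exists d : nat -> bool,
     dyadic_digits d (frac_part x) /\
     has_density [set i | (0 < i)%N /\ d i] (0 : R)].

Definition translate (R : realType) (A : set R) (t : R) : set R :=
  [set x + t | x in A].

Definition borel (R : realType) : set (set R) :=
  @measurable _ (measurableTypeR R).

(* A measure on R whose sigma-algebra is S is rendered as a measure on the
   measurable type g_sigma_algebraType S: its measurable sets are those of the
   sigma-algebra generated by S, that is, S itself when S is a sigma-algebra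
   (measurable_g_measurableTypeE). *)
Definition translation_invariant_borel_measure (R : realType)
    (S : set (set R)) (mu : {measure set (g_sigma_algebraType S) -> \bar R}) :
    Prop :=
  [/\ sigma_algebra setT S,
      @borel R `<=` S &
      forall (A : set R) (t : R), S A ->
        S (translate A t) /\ mu (translate A t) = mu A].

Definition immeasurable (R : realType) (B : set R) : Prop :=
  [/\ B !=set0,
      borel B &
      forall (S : set (set R))
             (mu : {measure set (g_sigma_algebraType S) -> \bar R}),
        translation_invariant_borel_measure mu ->
        mu B = 0%E \/ ~ @sigma_finite _ (g_sigma_algebraType S) R B mu].

(* Main.v *)
(* Write B for the set of numbers whose binary digits 1 have density zero.
   Counting carries shows that B is closed under addition.  Let mu be
   translation invariant and sigma-finite on B.  As in Egorov's theorem,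
   sigma-finiteness yields scales M_0 <= M_1 <= ... along which mu-almost every
   x in B has, for infinitely many k, fewer than M_k / 2(k+1) ones among its
   first M_k digits.  On the other hand there is t in B whose ones are spread so
   evenly that every x in B + t has, for all large k, at least M_k / 2(k+1) ones
   there: if the ones of b in B are much sparser than the gaps between the ones
   of t, hardly any gap of t can be filled by a run of carries.  Hence B + t is
   a null subset of B, and mu(B) = mu(B + t) = 0. *)

Require Import Defs.
From mathcomp Require Import all_boot all_order all_algebra.
From mathcomp Require Import all_classical all_reals all_analysis.
From mathcomp Require Import finmap zify ring lra.

Set Implicit Arguments.
Unset Strict Implicit.
Unset Printing Implicit Defensive.

Import Order.TTheory GRing.Theory Num.Theory.
Import numFieldNormedType.Exports.

Local Open Scope classical_set_scope.
Local Open Scope ring_scope.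

(** * Sparse digit sequences and carries *)

Definition ones (d : nat -> bool) (n : nat) : nat :=
  (\sum_(1 <= i < n.+1) d i)%N.

Lemma ones0 d : ones d 0 = 0%N.
Proof. by rewrite /ones big_geq. Qed.

Lemma onesS d n : ones d n.+1 = (ones d n + d n.+1)%N.
Proof. by rewrite /ones big_nat_recr. Qed.

(** Density zero in integer arithmetic; [has_densityP] gives the equivalence with the limit. *)
Definition sparse (d : nat -> bool) : Prop :=
  forall k, exists N, forall n, (N <= n)%N -> (k * ones d n <= n)%N.

(* [z] is the digit sequence, up to the integer part, of the sum of the numbers
   with digits [x] and [y]; [c n] is the carry into the [n]-th digit. *)
Definition adds_to (x y z : nat -> bool) : Prop :=
  exists c : nat -> bool,
    forall n, (z n.+1 + (c n).*2 = x n.+1 + y n.+1 + c n.+1)%N.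

Lemma ones_adds_to x y z n :
  adds_to x y z -> (ones z n <= ones x n + ones y n + 1)%N.
Proof.
move=> [c cE].
(* A carry trades two units for one, so only the carry [c n] arriving from beyond digit n can add a
   one. *)
suff: (ones z n + c 0%N <= ones x n + ones y n + c n)%N by lia.
by elim: n => [|n IH]; [rewrite !ones0|rewrite !onesS; have := cE n; lia].
Qed.

Lemma sparse_adds_to x y z : adds_to x y z -> sparse x -> sparse y -> sparse z.
Proof.
move=> xyz sx sy k.
have [N1 h1] := sx (4 * k)%N; have [N2 h2] := sy (4 * k)%N.
exists (N1 + N2 + 4 * k)%N => n hn.
have := ones_adds_to n xyz; have := h1 n; have := h2 n; nia.
Qed.

(** The fictitious position 0 counts as a digit 1. *)
Fixpoint last_one_dist (d : nat -> bool) (n : nat) : nat :=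
  if n is m.+1 then if d n then 0%N else (last_one_dist d m).+1 else 0%N.

(* A position where [z], [x] and [y] all have digit 0 neither receives nor
   produces a carry, and when reading towards the left the carry can only be
   resumed at a digit 1 of [z]; hence each digit 1 of [z] pays for at most [L]
   such positions. *)
Lemma ones_adds_to_ge x y z L n : adds_to x y z ->
  (forall i, (i <= n)%N -> (last_one_dist y i < L)%N) ->
  (n <= L * ones z n + ones x n + ones y n + L)%N.
Proof.
move=> [c cE] gap.
(* The slack [L] is sharpened for the induction: it is 0 when a carry enters digit n, and otherwise
   the distance to the last 1 of [y], which bounds the positions not yet paid for. *)
suff: (n <= L * ones z n + ones x n + ones y n +
            (if c n then 0 else last_one_dist y n))%N.
  by have := gap n (leqnn n); case: (c n); lia.
elim: n gap => [//|n IH] gap.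
have {}IH := IH (fun i hi => gap i (leqW hi)).
have := gap n (leqnSn n); have := cE n; rewrite !onesS /=.
move: IH; case: (c n); case: (c n.+1); case: (z n.+1); case: (x n.+1);
  case: (y n.+1) => //=; lia.
Qed.

(** * A sparse sequence with slowly growing gaps *)

Section SlowGaps.
Variable L : nat -> nat.

(** Greedy spacing: a 1 is placed as soon as the distance from the previous one reaches [L n]. The
    recursion runs on this distance, since the next digit depends on nothing else. *)
Fixpoint slow_dist (n : nat) : nat :=
  if n is m.+1 then if (L n <= (slow_dist m).+1)%N then 0%N
                    else (slow_dist m).+1
  else 0%N.

Definition slow_digits (n : nat) : bool :=
  if n is m.+1 then (L n <= (slow_dist m).+1)%N else false.

Lemma last_one_dist_slow n : last_one_dist slow_digits n = slow_dist n.
Proof. by elim: n => //= n ->. Qed.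

Lemma slow_dist_lt n : (forall i, (0 < L i)%N) -> (slow_dist n < L n)%N.
Proof.
move=> L0; case: n => [|n] /=; first exact: L0.
by case: ifP => [_|/negbT]; rewrite ?L0// -ltnNge.
Qed.

(** Once [L] is at least 2k, each new 1 uses up at least 2k units of distance, and each step
    supplies only one. Working with 2k instead of k lets the constant [C] of the initial segment be
    absorbed for large n. *)
Lemma sparse_slow_digits :
  (forall K, exists N, forall n, (N <= n)%N -> (K <= L n)%N) ->
  sparse slow_digits.
Proof.
move=> Loo k; have [N LN] := Loo k.*2.
set C := (k.*2 * ones slow_digits N + slow_dist N)%N.
have main n : (k.*2 * ones slow_digits (N + n) + slow_dist (N + n) <= n + C)%N.
  elim: n => [|n IH]; first by rewrite addn0.
  rewrite addnS onesS /=; have := LN (N + n).+1 ltac:(lia).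
  by case: (leqP (L _) (slow_dist _).+1) => /=; lia.
exists (N + C)%N => n hn; have := main (n - N)%N.
by rewrite subnKC; lia.
Qed.

End SlowGaps.

(* The gaps of [slow_digits L] are tuned to stay below [k.+1] up to the scale
   [M k], so that at that scale the density of the sum still exceeds
   [1 / 2(k+1)], whatever the sparse other summand. *)
Lemma exists_sparse_translation (M : nat -> nat) :
  {homo M : i j / (i <= j)%N} -> (forall k, (4 * k.+1 <= M k)%N) ->
  exists t, sparse t /\ forall x z, adds_to x t z -> sparse x ->
    exists j, forall k, (j <= k)%N -> (M k <= 2 * k.+1 * ones z (M k))%N.
Proof.
move=> Mhomo M4.
have Mge k : (k <= M k)%N by have := M4 k; lia.
(* One plus the number of scales below n. The cutoff [j < n] loses no scale, because [j <= M j]. *)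
pose L n := (\sum_(j < n) (M j < n)).+1.
have LM k i : (i <= M k)%N -> (L i <= k.+1)%N.
  move=> iM; rewrite /L ltnS.
  rewrite (eq_bigr (fun j : 'I_i => ((j < k) && (M j < i))%N : nat)); last first.
    move=> j _; case: (ltnP j k) => //= kj; rewrite ltnNge.
    by rewrite (leq_trans iM)// Mhomo.
  rewrite -(big_mkord xpredT (fun j => ((j < k) && (M j < i))%N : nat)).
  rewrite [leqRHS](_ : k = \sum_(0 <= j < k) 1)%N; last by rewrite sum_nat_const_nat; lia.
  case: (leqP i k) => ik.
    rewrite [leqRHS](@big_cat_nat _ _ _ i)//=.
    by apply: (leq_trans _ (leq_addr _ _)); apply: leq_sum => j _; case: (_ && _).
  rewrite (@big_cat_nat _ _ _ k _ _ _ _ (leq0n k) (ltnW ik))/=.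
  rewrite [X in (_ + X)%N]big_nat_cond [X in (_ + X)%N]big1 ?addn0.
    by apply: leq_sum => j _; case: (_ && _).
  by move=> j /andP[/andP[kj _] _]; rewrite ltnNge kj.
have Loo K : exists N, forall n, (N <= n)%N -> (K <= L n)%N.
  exists (M K).+1 => n Mn; rewrite /L.
  have Kn : (K <= n)%N by have := Mge K; lia.
  apply: leqW; rewrite -(big_mkord xpredT (fun j => (M j < n)%N : nat)).
  rewrite (@big_cat_nat _ _ _ K _ _ _ _ (leq0n K) Kn)/=.
  apply: (leq_trans _ (leq_addr _ _)).
  rewrite (eq_big_nat _ _ (F2 := fun=> 1%N)); first by rewrite sum_nat_const_nat; lia.
  by move=> j /andP[_ jK]; rewrite (leq_ltn_trans (Mhomo _ _ (ltnW jK))).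
pose t := slow_digits L.
have tsparse : sparse t by exact: sparse_slow_digits.
exists t; split => // x z xtz xsparse.
(* With [M4], the error terms from [x], from [t] and from the last gap are at most 1/8, 1/8 and 1/4
   of [M k], which leaves half of it for the ones of [z]. *)
have [N1 h1] := xsparse 8; have [N2 h2] := tsparse 8.
exists (N1 + N2)%N => k hk.
have gap i : (i <= M k)%N -> (last_one_dist t i < k.+1)%N.
  move=> iM; rewrite last_one_dist_slow; apply: leq_trans (LM _ _ iM).
  exact: slow_dist_lt.
have := ones_adds_to_ge xtz gap.
have := h1 (M k); have := h2 (M k); have := Mge k; have := M4 k; lia.
Qed.

(** * Binary digits of real numbers *)

Section Digits.
Variable R : realType.
Implicit Types (x y t : R) (d : nat -> bool) (n m : nat).

Definition scaled_floor x n : int := Num.floor (2 ^+ n * x).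

(** This parity makes sense for negative x too, and at dyadic rationals it yields the terminating
    expansion. *)
Definition digit x n : bool := odd `|scaled_floor x n|%N.

Lemma scaled_floor_itv x n :
  (scaled_floor x n)%:~R <= 2 ^+ n * x < (scaled_floor x n)%:~R + 1.
Proof. by have := floor_itv (2 ^+ n * x); rewrite intrD. Qed.

Lemma scaled_floorS x n :
  scaled_floor x n.+1 = 2 * scaled_floor x n + (digit x n.+1 : nat)%:Z.
Proof.
have /andP[h1 h2] := scaled_floor_itv x n.
have /andP[h3 h4] := scaled_floor_itv x n.+1.
rewrite exprS -mulrA in h3 h4; rewrite /digit.
move: (scaled_floor x n) (scaled_floor x n.+1) (2 ^+ n * x) h1 h2 h3 h4.
move=> a b w h1 h2 h3 h4.
have : (2 * a < b + 1)%R by rewrite -(ltr_int R) intrM intrD; lra.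
have : (b < 2 * a + 2)%R by rewrite -(ltr_int R) intrD intrM; lra.
lia.
Qed.

Lemma adds_to_digit x y : adds_to (digit x) (digit y) (digit (x + y)).
Proof.
(* The floor of a sum exceeds the sum of the floors by 0 or 1; this excess is the carry. *)
exists (fun n => scaled_floor x n + scaled_floor y n < scaled_floor (x + y) n) => n.
have carry m : scaled_floor (x + y) m = scaled_floor x m + scaled_floor y m +
    ((scaled_floor x m + scaled_floor y m < scaled_floor (x + y) m)%R : nat)%:Z.
  have /andP[h1 h2] := scaled_floor_itv x m.
  have /andP[h3 h4] := scaled_floor_itv y m.
  have /andP[h5 h6] := scaled_floor_itv (x + y) m.
  rewrite mulrDr in h5 h6.
  move: (scaled_floor x m) (scaled_floor y m) (scaled_floor (x + y) m)
    h1 h2 h3 h4 h5 h6 => a b c h1 h2 h3 h4 h5 h6.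
  have : (a + b < c + 1)%R by rewrite -(ltr_int R) !intrD; lra.
  have : (c < a + b + 2)%R by rewrite -(ltr_int R) !intrD; lra.
  lia.
have := carry n; have := carry n.+1.
have := scaled_floorS x n; have := scaled_floorS y n; have := scaled_floorS (x + y) n.
by set p := (_ < _)%R; set q := (_ < _)%R; lia.
Qed.

Lemma digit_frac_part x n : digit (frac_part x) n.+1 = digit x n.+1.
Proof.
rewrite /digit.
have -> : scaled_floor (frac_part x) n.+1 =
    scaled_floor x n.+1 - 2 * (2 ^+ n * Num.floor x).
  apply: floor_def; have := scaled_floor_itv x n.+1.
  rewrite /frac_part mulrBr !(intrD, intrN, intrM, rmorphXn)/= exprS; lra.
by move: (2 ^+ n * _)%R => a; lia.
Qed.

Lemma frac_part_itv x : 0 <= frac_part x < 1.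
Proof. by have := floor_itv x; rewrite intrD /frac_part; lra. Qed.

Fixpoint numerator d n : nat :=
  if n is m.+1 then ((numerator d m).*2 + d n)%N else 0%N.

Lemma dyadic_sumE d n :
  \sum_(1 <= i < n.+1) (d i)%:R / 2 ^+ i = (numerator d n)%:R / 2 ^+ n :> R.
Proof.
elim: n => [|n IH]; first by rewrite big_geq// mul0r.
rewrite big_nat_recr//= IH natrD -mul2n natrM exprS; field.
by rewrite expf_neq0// pnatr_eq0.
Qed.

Lemma numerator_addn d n m :
  (2 ^ m * numerator d n <= numerator d (n + m) < 2 ^ m * (numerator d n).+1)%N.
Proof.
elim: m => [|m IH]; first by rewrite addn0; lia.
by rewrite addnS /= expnS; case: (d _); lia.
Qed.

(** The upper bound is not strict, because a tail of ones attains it. *)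
Definition dyadic_bracket d y : Prop :=
  forall n, (numerator d n)%:R <= 2 ^+ n * y <= (numerator d n)%:R + 1.

Lemma exp2_gt0 n : 0 < 2 ^+ n :> R.
Proof. exact: exprn_gt0. Qed.

Lemma dyadic_expansionP d y : is_dyadic_expansion d y <-> dyadic_bracket d y.
Proof.
rewrite /is_dyadic_expansion (funext (dyadic_sumE d)).
split=> [dy n|br].
  have yE := cvg_lim (@Rhausdorff R) dy.
  have cv : cvgn (fun n => (numerator d n)%:R / 2 ^+ n : R) by exact: cvgP dy.
  have lb : forall m, (n <= m)%N ->
     (numerator d n)%:R / 2 ^+ n <= (numerator d m)%:R / 2 ^+ m :> R.
    move=> m nm; rewrite ler_pdivrMr ?exp2_gt0// mulrAC ler_pdivlMr ?exp2_gt0//.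
    rewrite -(subnKC nm); have /andP[+ _] := numerator_addn d n (m - n).
    rewrite -(ler_nat R) natrM natrX exprD.
    by move/(ler_wpM2r (ltW (exp2_gt0 n))); lra.
  have ub : forall m, (n <= m)%N ->
     (numerator d m)%:R / 2 ^+ m <= ((numerator d n)%:R + 1) / 2 ^+ n :> R.
    move=> m nm; rewrite ler_pdivrMr ?exp2_gt0// mulrAC ler_pdivlMr ?exp2_gt0//.
    rewrite -(subnKC nm); have /andP[_ /ltnW] := numerator_addn d n (m - n).
    rewrite -(ler_nat R) natrM natrX exprD -natr1.
    by move/(ler_wpM2r (ltW (exp2_gt0 n))); lra.
  rewrite ![2 ^+ n * y]mulrC; apply/andP; split.
    by rewrite -ler_pdivrMr ?exp2_gt0// -yE; apply: limr_ge => //; exists n.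
  by rewrite -ler_pdivlMr ?exp2_gt0// -yE; apply: limr_le => //; exists n.
have half0 : (fun n => (2^-1 : R) ^+ n) @ \oo --> (0 : R).
  by apply: cvg_expr; rewrite ger0_norm; lra.
have lo : (fun n => y - (2^-1 : R) ^+ n) @ \oo --> y.
  by rewrite -[X in _ --> X]subr0; apply: cvgB => //; exact: cvg_cst.
apply: (squeeze_cvgr _ lo (cvg_cst y)); apply: nearW => n /=.
have /andP[h1 h2] := br n.
apply/andP; split; last by rewrite ler_pdivrMr ?exp2_gt0// mulrC.
by rewrite lerBlDr exprVn -[X in _ + X]mul1r -mulrDl ler_pdivlMr ?exp2_gt0// mulrC.
Qed.

Lemma dyadic_expansion_digit y : 0 <= y < 1 -> is_dyadic_expansion (digit y) y.
Proof.
move=> y01; apply/dyadic_expansionP => n.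
suff -> : (numerator (digit y) n)%:R = (scaled_floor y n)%:~R :> R.
  by have := scaled_floor_itv y n; lra.
suff -> : scaled_floor y n = (numerator (digit y) n)%:Z by [].
elim: n => [|n IH]; last first.
  by rewrite scaled_floorS IH [numerator _ _.+1]/= -mul2n PoszD PoszM.
by apply: floor_def; rewrite expr0 mul1r add0r; exact: y01.
Qed.

Lemma dyadic_expansion_uniq d y :
  (forall N, exists2 j, (N < j)%N & ~~ d j) -> is_dyadic_expansion d y ->
  forall n, d n.+1 = digit y n.+1.
Proof.
move=> dzeros /dyadic_expansionP br.
(* A zero digit beyond n keeps the tail below one full unit, so that [numerator d n] is the
   floor. *)
have strict n : 2 ^+ n * y < (numerator d n)%:R + 1.
  have [[//|j] nj dj] := dzeros n.
  have /andP[_ h] := br j.+1; move: h; rewrite /= (negbTE dj) addn0.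
  have /andP[_ h] := numerator_addn d n (j - n).
  move: h; rewrite subnKC// -(ler_nat R) natrM natrX.
  rewrite -[(numerator d j).+1%:R]natr1 -[(numerator d n).+1%:R]natr1 => h.
  rewrite exprS -mul2n natrM => h2.
  by rewrite -(ltr_pM2l (exp2_gt0 (j - n))) mulrA -exprD subnK//; lra.
have sf n : scaled_floor y n = (numerator d n)%:Z.
  apply: floor_def; rewrite intrD strict andbT.
  by have /andP[] := br n.
move=> n; have := scaled_floorS y n; rewrite !sf/=.
by case: (d _); case: (digit _ _) => //=; lia.
Qed.

(** The tail of ones amounts to one unit of digit N, so [2 ^+ N * y] is an integer and all later
    floors are even. *)
Lemma digit_eq0 d y N : (forall j, (N < j)%N -> d j) -> is_dyadic_expansion d y ->
  forall n, (N < n)%N -> digit y n = false.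
Proof.
move=> dones /dyadic_expansionP br.
have numE m : ((numerator d (N + m)).+1 = 2 ^ m * (numerator d N).+1)%N.
  elim: m => [|m IH]; first by rewrite addn0 mul1n.
  by rewrite addnS /= dones ?ltnS ?leq_addr// expnS; lia.
have yE : 2 ^+ N * y = (numerator d N).+1%:R.
  apply/eqP; rewrite eq_le; apply/andP; split.
    by rewrite -[(numerator d N).+1%:R]natr1; have /andP[] := br N.
  apply/ler_addgt0Pr => e e0.
  have [m me] : exists m, e^-1 < 2 ^+ m.
    exists (Num.bound e^-1); apply: (lt_le_trans (archi_boundP _)).
      by rewrite invr_ge0 ltW.
    by rewrite -natrX ler_nat ltnW// ltn_expl.
  have /andP[h _] := br (N + m)%N.
  have h2 : (numerator d (N + m))%:R + 1 = 2 ^+ m * (numerator d N).+1%:R :> R.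
    by rewrite natr1 numE natrM natrX.
  rewrite -(ler_pM2l (exp2_gt0 m)) mulrDr mulrA -exprD (addnC m).
  have : 1 <= 2 ^+ m * e by rewrite -ler_pdivrMr// div1r ltW.
  lra.
move=> n /subnKC <-; rewrite addSnnS.
rewrite /digit (_ : scaled_floor _ _ = (2 ^ (n - N.+1).+1 * (numerator d N).+1)%N).
  by rewrite expnS -mulnA mul2n absz_nat odd_double.
apply: floor_def; rewrite addnC exprD -mulrA yE intrD -natrX -natrM.
by rewrite lexx ltrDl ltr01.
Qed.

(** Two expansions compete only if one ends in ones and the other in zeros; the finiteness clause
    selects the latter, as [digit] does. *)
Lemma dyadic_digitsP d y : 0 <= y < 1 ->
  dyadic_digits d y <-> forall n, d n.+1 = digit y n.+1.
Proof.
move=> y01; split=> [[dy fin]|dE].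
  apply: contrapT => /existsNP[n /eqP dn].
  have finite_d : finite_set [set i | (0 < i)%N /\ d i].
    apply: fin; exists (digit y); split; first exact: dyadic_expansion_digit.
    by exists n.+1 => //; rewrite eq_sym.
  have [N hN] : exists N, forall j, (N < j)%N -> ~~ d j.
    have /finite_seqP[s sE] := finite_d.
    exists (\max_(i <- s) i)%N => j; apply: contraTN => dj.
    have [->//|j0] := posnP j.
    have : j \in s by have : [set` s] j by rewrite -sE.
    by rewrite -leqNgt => js; exact: leq_bigmax_seq.
  have dz N' : exists2 j, (N' < j)%N & ~~ d j.
    by exists (maxn N N').+1; [|apply: hN]; lia.
  by move: dn; rewrite (dyadic_expansion_uniq dz dy) eqxx.
have dy : is_dyadic_expansion d y.
  rewrite /is_dyadic_expansion (_ : (fun n => _) =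
    fun n => \sum_(1 <= i < n.+1) (digit y i)%:R / 2 ^+ i).
    exact: dyadic_expansion_digit.
  by apply/funext => n; rewrite !big_add1; apply: eq_bigr => i _; rewrite dE.
split=> // -[d' [d'y [[//|i] _ di]]].
have [dz|/existsNP[N hN]] := pselect (forall N, exists2 j, (N < j)%N & ~~ d' j).
  by move: di; rewrite (dyadic_expansion_uniq dz d'y) dE eqxx.
have ones' j : (N < j)%N -> d' j.
  by move=> Nj; apply: contrapT => /negP dj; apply: hN; exists j.
apply: (@sub_finite_set _ _ `I_N.+1); last exact: finite_II.
move=> [[]//|j] [_ dj] /=; rewrite ltnNge; apply/negP => Nj.
by move: dj; rewrite dE (digit_eq0 ones' d'y).
Qed.

Lemma card_ones d n :
  #|` fset_set ([set i | (0 < i)%N /\ d i] `&` [set i | (1 <= i <= n)%N])|%fset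
  = ones d n.
Proof.
pose s := [seq i <- index_iota 1 n.+1 | d i].
have -> : [set i | (0 < i)%N /\ d i] `&` [set i | (1 <= i <= n)%N]
          = [set` [fset i in s]%fset].
  apply/seteqP; split => i /=; rewrite !inE mem_filter mem_index_iota ltnS.
    by move=> [[_ ->] ->].
  by move=> /and3P[-> -> ->].
rewrite set_fsetK card_fseq undup_id ?filter_uniq ?iota_uniq//.
by rewrite size_filter -sum1_count big_mkcond /ones; apply: eq_bigr => i _; case: (d i).
Qed.

Lemma has_densityP d : has_density [set i | (0 < i)%N /\ d i] (0 : R) <-> sparse d.
Proof.
rewrite /has_density (_ : (fun n => _) = fun n => (ones d n)%:R / n%:R); last first.
  by apply/funext => n; rewrite card_ones.
split=> [/cvgrPdist_le h k|sd].
  have [->|k0] := posnP k; first by exists 0%N.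
  have [|N _ hN] := h k%:R^-1; first by rewrite invr_gt0 ltr0n.
  exists N.+1 => n Nn; have := hN n (ltnW Nn).
  have n0 : (0 < n)%N by apply: leq_trans Nn.
  rewrite /= sub0r normrN ger0_norm ?divr_ge0//.
  rewrite ler_pdivrMr ?ltr0n// ler_pdivlMl ?ltr0n//.
  by rewrite -natrM ler_nat.
apply/cvgrPdist_le => e e0.
pose k := (Num.bound e^-1).
have ke : e^-1 < k%:R by apply: archi_boundP; rewrite invr_ge0 ltW.
have k0 : 0 < k%:R :> R by apply: lt_trans ke; rewrite invr_gt0.
have [N hN] := sd k; exists N.+1 => // n /= Nn.
have n0 : (0 < n)%N by apply: leq_trans Nn.
rewrite sub0r normrN ger0_norm ?divr_ge0// ler_pdivrMr ?ltr0n//.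
have := hN n (ltnW Nn); rewrite -(ler_nat R) natrM => h.
rewrite -(ler_pM2l k0); apply: (le_trans h).
rewrite mulrA ler_peMl// mulrC -ler_pdivrMl// mulr1 ltW//.
Qed.

Lemma BE10P x : BE10 x <-> sparse (digit x).
Proof.
have onesE d : (forall n, d n.+1 = digit (frac_part x) n.+1) ->
    ones d =1 ones (digit x).
  by move=> dE; elim=> [|n IH]; rewrite ?ones0// !onesS IH dE digit_frac_part.
split=> [[d [/(dyadic_digitsP _ (frac_part_itv x)) dE /has_densityP sd]] k|sx].
  have [N hN] := sd k; exists N => n; rewrite -(onesE _ dE); exact: hN.
exists (digit (frac_part x)); split.
  by apply/dyadic_digitsP => //; exact: frac_part_itv.
apply/has_densityP => k; have [N hN] := sx k; exists N => n; rewrite onesE//; exact: hN.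
Qed.

(** Sparsity rules out a tail of ones, so the number with expansion [d] has exactly these digits. *)
Lemma exists_digit d : sparse d -> exists t, forall n, digit t n.+1 = d n.+1.
Proof.
move=> sd.
have zeros N : exists2 j, (N < j)%N & ~~ d j.
  apply: contrapT => no; have [N' hN'] := sd 2%N.
  have dj j : (N < j)%N -> d j.
    by move=> Nj; apply: contrapT => /negP dj; apply: no; exists j.
  have : forall m, (ones d (N + m) >= m)%N.
    elim=> [//|m IH]; rewrite addnS onesS dj ?ltnS ?leq_addr//; lia.
  move=> /(_ (N + N').+1); have := hN' (N + (N + N').+1)%N; lia.
pose u : R ^nat := fun n => \sum_(1 <= i < n.+1) (d i)%:R / 2 ^+ i.
have : cvgn u.
  apply: nondecreasing_is_cvgn.
    apply/nondecreasing_seqP => n; rewrite /u [leRHS]big_nat_recr//= lerDl.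
    by apply: divr_ge0; [exact: ler0n|exact/ltW/exp2_gt0].
  exists 1 => _ [n _ <-]; rewrite /u dyadic_sumE ler_pdivrMr ?exp2_gt0// mul1r.
  have /andP[_ +] := numerator_addn d 0 n; rewrite add0n muln1 => /ltnW.
  by rewrite -(ler_nat R) natrX.
move=> cu; exists (limn u) => n.
by rewrite -(@dyadic_expansion_uniq d).
Qed.

End Digits.

(** * Borel measurability of digit conditions *)

Section Measurability.
Variable R : realType.

Lemma borel_digit n : borel [set x : R | digit x n].
Proof.
have -> : [set x : R | digit x n] = \bigcup_(z : int)
    if odd `|z|%N then [set` `[z%:~R / 2 ^+ n, (z%:~R + 1) / 2 ^+ n[ ] else set0.
  have inE z (x : R) : x \in `[z%:~R / 2 ^+ n, (z%:~R + 1) / 2 ^+ n[ =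
                   (scaled_floor x n == z).
    rewrite in_itv/= ler_pdivrMr ?exp2_gt0// ltr_pdivlMr ?exp2_gt0//.
    by rewrite /scaled_floor floor_eq intrD mulrC.
  apply/seteqP; split => [x /= xn|x [z _]].
    by exists (scaled_floor x n) => //; rewrite -/(digit x n) xn /= inE.
  by case: ifP => //= zodd; rewrite inE => /eqP xz; rewrite /digit xz.
apply: countable_bigcupT_measurable => // z.
by case: ifP => // _; exact: measurable_itv.
Qed.

(** A general [P] lets the induction absorb the last digit by passing to [P \o succn]. *)
Lemma borel_ones (P : set nat) n : borel [set x : R | P (ones (digit x) n)].
Proof.
elim: n P => [|n IH] P.
  have [p0|np0] := pselect (P 0%N).
    rewrite (_ : [set _ | _] = setT); first exact: measurableT.
    by apply/seteqP; split => x //= _; rewrite ones0.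
  rewrite (_ : [set _ | _] = set0); first exact: measurable0.
  by apply/seteqP; split => x //=; rewrite ones0.
rewrite (_ : [set _ | _] =
  ([set x | P (ones (digit x) n).+1] `&` [set x | digit x n.+1]) `|`
  ([set x | P (ones (digit x) n)] `\` [set x | digit x n.+1])).
  apply: measurableU; first exact: measurableI (IH (P \o succn)) (borel_digit _).
  exact: measurableD (IH P) (borel_digit _).
apply/seteqP; split=> x /=; rewrite onesS; case: (digit x n.+1) => /=.
- by rewrite addn1; left.
- by rewrite addn0; right.
- by rewrite addn1 => -[[]|[]].
- by rewrite addn0 => -[[]|[]].
Qed.

Lemma borel_BE10 : borel (@BE10 R).
Proof.
rewrite (_ : BE10 (R:=R) = \bigcap_k \bigcup_N \bigcap_(n in [set n | (N <= n)%N])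
    [set x : R | (k * ones (digit x) n <= n)%N]).
  apply: bigcapT_measurable => k; apply: bigcup_measurable => N _.
  by apply: bigcap_measurableType => n _; exact: (borel_ones [set m | (k * m <= n)%N]).
apply/seteqP; split => x; rewrite BE10P.
  by move=> sx k _; have [N hN] := sx k; exists N.
by move=> h k; have [N _ hN] := h k Logic.I; exists N.
Qed.

Lemma BE10_neq0 : @BE10 R !=set0.
Proof.
exists 0; apply/BE10P => k; exists 0%N => n _.
suff -> : ones (digit (0 : R)) n = 0%N by rewrite muln0.
elim: n => [|n IH]; first exact: ones0.
by rewrite onesS IH /digit /scaled_floor mulr0 floor0.
Qed.

End Measurability.

(** * Translation invariant measures *)

Section NullOrNonSigmaFinite.
Variables (R : realType) (S : set (set R)).
Variable mu : {measure set (g_sigma_algebraType S) -> \bar R}.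
Hypothesis mu_inv : translation_invariant_borel_measure mu.

Let borel_measurable (A : set R) : borel A -> @measurable _ (g_sigma_algebraType S) A.
Proof.
by case: mu_inv => _ bS _ bA; apply: sub_sigma_algebra; exact: bS.
Qed.

Let mu_le (A B : set (g_sigma_algebraType S)) :
  measurable A -> measurable B -> A `<=` B -> (mu A <= mu B)%E.
Proof. by move=> mA mB; apply: le_measure; exact/mem_set. Qed.

Let dense_at k M : set R :=
  [set x | BE10 x /\ (M <= 2 * k.+1 * ones (digit x) M)%N].

Let measurable_dense_at k M : @measurable _ (g_sigma_algebraType S) (dense_at k M).
Proof.
apply: borel_measurable; apply: measurableI; first exact: borel_BE10.
exact: (borel_ones [set m | (M <= 2 * k.+1 * m)%N]).
Qed.

(** Egorov's argument: the tail unions decrease to the empty set, and continuity from above applies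
    since [A] has finite measure. *)
Lemma eventually_sparse_measure (A : set (g_sigma_algebraType S)) k (e : R) :
  measurable A -> (mu A < +oo)%E -> 0 < e ->
  exists N, forall M, (N <= M)%N -> (mu (A `&` dense_at k M) <= e%:E)%E.
Proof.
move=> mA Afin e0.
pose G N := A `&` \bigcup_(M in [set M | (N <= M)%N]) dense_at k M.
have mG N : measurable (G N).
  apply: measurableI => //; apply: bigcup_measurable => M _.
  exact: measurable_dense_at.
have G0 : \bigcap_N G N = set0.
  apply/seteqP; split=> // x xG.
  have [_ [M0 _ [/BE10P sx _]]] := xG 0%N Logic.I.
  (* One more than the factor in [dense_at]: the two bounds together force M = 0, which the index
     [N.+1] below excludes. *)
  have [N hN] := sx (2 * k.+1).+1.
  have [_ [M /= NM [_ hM]]] := xG N.+1 Logic.I.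
  have := hN M (ltnW NM); rewrite mulSn; move: hM NM; case: (ones _ _) => [|p]; lia.
have [N GN] : exists N, (mu (G N) <= e%:E)%E.
  apply: contrapT => /forallNP no.
  have : (e%:E <= 0)%E.
    have : mu (G n) @[n --> \oo] --> mu (\bigcap_N G N).
      apply: nonincreasing_cvg_mu => //.
      - by apply: le_lt_trans Afin; apply: mu_le => //; exact: subIsetl.
      - exact: bigcapT_measurable.
      - move=> n m nm; apply/subsetPset; apply: setIS => x [M /= mM xM].
        by exists M => //=; exact: leq_trans mM.
    rewrite G0 measure0; apply: cvge_ge; apply: nearW => n.
    by apply/ltW; rewrite ltNge; apply/negP; exact: no.
  by rewrite lee_fin leNgt e0.
exists N => M NM; apply: le_trans GN; apply: mu_le => //.
  exact: measurableI.
by apply: setIS => x xM; exists M.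
Qed.

Lemma BE10_null_or_not_sigma_finite :
  mu (@BE10 R) = 0%E \/ ~ sigma_finite (@BE10 R : set (g_sigma_algebraType S)) mu.
Proof.
have [[F BF Ffin]|] := pselect (sigma_finite (@BE10 R : set (g_sigma_algebraType S)) mu);
  last by right.
left.
have [N hN] : {N : nat -> nat -> nat & forall k i M, (N k i <= M)%N ->
    (mu (F i `&` dense_at k M) <= (k.+1%:R^-1)%:E)%E}.
  have /choice[N hN] : forall k, exists N : nat -> nat, forall i M, (N i <= M)%N ->
      (mu (F i `&` dense_at k M) <= (k.+1%:R^-1)%:E)%E.
    move=> k; have /choice[N hN] : forall i, exists N, forall M, (N <= M)%N ->
        (mu (F i `&` dense_at k M) <= (k.+1%:R^-1)%:E)%E.
      move=> i; have [mF Foo] := Ffin i.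
      by apply: eventually_sparse_measure => //; rewrite invr_gt0 ltr0n.
    by exists N.
  by exists N.
(* Summing all thresholds with i <= k' <= k makes [M] monotone and at least each [N k i] with i <=
   k; the last term supplies the lower bound that [exists_sparse_translation] requires. *)
pose M k := (\sum_(0 <= k' < k.+1) (\sum_(0 <= i < k'.+1) N k' i) + 4 * k.+1)%N.
have MN k i : (i <= k)%N -> (N k i <= M k)%N.
  rewrite -ltnS => ik; rewrite /M big_nat_recr//= (big_mkord xpredT (N k)).
  by rewrite [X in (_ + X + _)%N](bigD1 (Ordinal ik))//=; lia.
have Mhomo : {homo M : i j / (i <= j)%N}.
  move=> i j ij; rewrite /M leq_add// ?leq_mul//.
  by rewrite [leqRHS](@big_cat_nat _ _ _ i.+1)//= leq_addr.
have [d [sd dP]] : exists t, sparse t /\ forall x z, adds_to x t z -> sparse x ->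
    exists j, forall k, (j <= k)%N -> (M k <= 2 * k.+1 * ones z (M k))%N.
  by apply: exists_sparse_translation => // k; exact: leq_addl.
have [t tE] := exists_digit R sd.
have add_t x : adds_to (digit x) d (digit (x + t)).
  by have [c cE] := adds_to_digit x t; exists c => n; rewrite cE tE.
have [_ bS tinv] := mu_inv.
have [St muE] := tinv _ t (bS _ (@borel_BE10 R)).
(* By invariance it suffices that the translate is null; it will be covered by the countably many
   sets [Z i j]. *)
rewrite -muE.
have mt : @measurable _ (g_sigma_algebraType S) (translate (@BE10 R) t).
  exact: sub_sigma_algebra.
apply: measure_negligible => //.
pose Z i j := F i `&` \bigcap_(k in [set k | (j <= k)%N]) dense_at k (M k).
apply: (@negligibleS _ _ _ _ (\bigcup_i \bigcup_j Z i j)).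
  move=> _ [x xB <-]; have /BE10P sx := xB.
  have xtB : BE10 (x + t) by apply/BE10P; exact: sparse_adds_to (add_t x) sx sd.
  have [i _ Fi] : (\bigcup_i F i) (x + t) by rewrite -BF.
  have [j hj] := dP _ _ (add_t x) sx.
  exists i => //; exists j => //; split => // k jk; split => //; exact: hj.
apply: negligible_bigcup => i; apply: negligible_bigcup => j.
have mFi : measurable (F i) by have [] := Ffin i.
have mZ : measurable (Z i j).
  apply: measurableI => //; apply: bigcap_measurableType => k _.
  exact: measurable_dense_at.
apply/negligibleP => //; apply/eqP; rewrite eq_le measure_ge0 andbT.
(* For each k beyond both i and j, [Z i j] lies in the dense part of [F i] at scale [M k], of
   measure at most 1/(k+1). *)
apply: (cvge_ge _ cvge_harmonic); exists (maxn i j) => // k /= ijk.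
have [ik jk] : (i <= k)%N /\ (j <= k)%N by lia.
apply: le_trans (hN k i (M k) (MN _ _ ik)); apply: mu_le => //.
  exact: measurableI.
by apply: setIS => x; apply.
Qed.

End NullOrNonSigmaFinite.

Theorem theorem2p7 (R : realType) : immeasurable (@BE10 R).
Proof.
split; [exact: BE10_neq0|exact: borel_BE10|].
by move=> S mu mu_inv; exact: BE10_null_or_not_sigma_finite.
Qed.
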